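(* Let $g\in\mathbb{C}[[x,y]]$ be a formal power series with $\partial g/\partial y\neq0$, let $h\in\mathbb{C}[[x]]$ be a non-zero formal power series with $h(0)=0$, let $E$ be a closed subset of $\mathbb{C}\setminus\{0\}$ with $\operatorname{cap}(E)>0$, and let $(\sigma,\tau)$ be a pair of integers with $\sigma\tau>0$. Suppose that $g(s^\sigma x,s^\tau h(x))$ is convergent for each $s\in E$. Then $h$ is convergent.
   Context: $\mathbb{C}[[x_1,\dots,x_n]]$ is the set of formal power series $\sum a_{k_1\dots k_n}x_1^{k_1}\cdots x_n^{k_n}$ with complex coefficients; $h(0)$ denotes the constant coefficient of $h$. A power series is convergent if there is a constant $C$ such that $|a_{k_1\dots k_n}|\le C^{k_1+\cdots+k_n}$ for all $(k_1,\dots,k_n)\ne(0,\dots,0)$ (equivalently, it converges in some neighborhood of the origin). For $g=\sum a_{ij}x^iy^j$, $\partial g/\partial y=\sum ja_{ij}x^iy^{j-1}$ is the formal partial derivative; thus $\partial g/\partial y\ne0$ means $g\notin\mathbb{C}[[x]]$. For $s\in\mathbb{C}\setminus\{0\}$ and $h(0)=0$, $g(s^\sigma x,s^\tau h(x))$ is the well-defined element of $\mathbb{C}[[x]]$ obtained by formal substitution. $\operatorname{cap}$ denotes logarithmic capacity: for a compact set $E\subset\mathbb{C}$, $\operatorname{cap}(E)=\exp\left(-\min_{\mu}\sup_{z\in\mathbb{C}}p_\mu(z)\right)$, where $\mu$ ranges over probability measures on $E$ and $p_\mu(z)=\lim_{N\to\infty}\int\min\left(N,\log\frac{1}{|z-\zeta|}\right)d\mu(\zeta)$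 (equal to the transfinite diameter of $E$); for a closed set $E$, $\operatorname{cap}(E)=\lim_n\operatorname{cap}(E\cap\{|z|\le n\})$. *)

(* Defs.v *)
From HB Require Import structures.
From mathcomp Require Import all_boot all_order all_algebra.
From mathcomp Require Import complex.
From mathcomp Require Import all_classical all_reals all_analysis.
Set Implicit Arguments.
Unset Strict Implicit.
Unset Printing Implicit Defensive.
Import Order.TTheory GRing.Theory Num.Theory numFieldNormedType.Exports.
Local Open Scope classical_set_scope.
Local Open Scope ring_scope.

(* The coefficient families [nat -> K] and [nat -> nat -> K] stand for the
   formal power series rings K[[x]] and K[[x, y]]. *)
Section FormalPowerSeries.
Variable K : comNzRingType.
Implicit Types (u v : nat -> K) (g : nat -> nat -> K).

Definition fps_one : nat -> K := fun n => (n == 0%N)%:R.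

Definition fps_X : nat -> K := fun n => (n == 1%N)%:R.

Definition fps_scale (c : K) u : nat -> K := fun n => c * u n.

Definition fps_mul u v : nat -> K :=
  fun n => \sum_(i < n.+1) u i * v (n - i)%N.

Definition fps_exp u (k : nat) : nat -> K := iter k (fps_mul u) fps_one.

Definition fps_dy g : nat -> nat -> K := fun i j => g i j.+1 *+ j.+1.

(* The series g(u(x), v(x)), meaningful only when u and v have zero constant
   coefficient: then u^i v^j has order at least i + j, so only the terms with
   i <= n and j <= n contribute to the coefficient of x^n. *)
Definition fps_subst2 g u v : nat -> K :=
  fun n => \sum_(i < n.+1) \sum_(j < n.+1)
             g i j * fps_mul (fps_exp u i) (fps_exp v j) n.

End FormalPowerSeries.

Arguments fps_one {K}.
Arguments fps_X {K}.

(* [R[i]^o] is the complex plane with the topology of its modulus. *)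
Notation borelC R := (g_sigma_algebraType (@open R[i]^o)).

Section ComplexPlane.
Variable R : realType.

(* The modulus as an element of R; the generic norm of R[i] takes its values
   in R[i]. *)
Definition modC (z : R[i]) : R := complex.Re `|z|.

Definition fps_convergent (u : nat -> R[i]) : Prop :=
  exists C : R, forall k : nat, (0 < k)%N -> modC (u k) <= C ^+ k.

(* Closed for the relative topology of the punctured plane. *)
Definition closed_in_Cstar (E : set R[i]) : Prop :=
  exists2 F : set R[i], @closed R[i]^o F & E = F `\ 0.

(* log (1 / |z - w|), with value +oo at w = z since lne 0 = -oo. *)
Definition log_kernel (z w : R[i]) : \bar R := (- lne (modC (z - w))%:E)%E.

Definition log_potential (mu : probability (borelC R) R) (z : R[i]) : \bar R :=
  limn (fun N : nat => (\int[mu]_w mine N%:R%:E (log_kernel z w))%E).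

(* Probability measures on K are Borel probability measures on the plane giving
   mass 1 to K. For nonempty compact K the infimum is a minimum; it is +oo for
   K empty, which then has capacity 0. *)
Definition cap_compact (K : set R[i]) : \bar R :=
  expeR (- ereal_inf [set ereal_sup (range (log_potential mu))
                     | mu in [set mu : probability (borelC R) R
                                   | mu K = 1%E]])%E.

(* For E closed in the punctured plane but not in the plane, the truncations
   need not be compact; [cap_compact] is then the inner capacity of a Borel set
   and the value is that of the closed set E `|` [set 0]. *)
Definition cap (E : set R[i]) : \bar R :=
  limn (fun n : nat => cap_compact (E `&` [set z | modC z <= n%:R])).

End ComplexPlane.

(* Main.v *)
Require Import Defs.
From HB Require Import structures.
From mathcomp Require Import all_boot all_order all_algebra.
From mathcomp Require Import complex.
From mathcomp Require Import ring lra zify.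
From mathcomp Require Import all_classical all_reals all_analysis.
From mathcomp Require Import measurable_realfun.
Set Implicit Arguments.
Unset Strict Implicit.
Unset Printing Implicit Defensive.
Import Order.TTheory GRing.Theory Num.Theory numFieldNormedType.Exports.
Local Open Scope classical_set_scope.
Local Open Scope ring_scope.

(** The coefficient of x^n in g(s^sigma x, s^tau h(x)) is, up to replacing s by
1/s, a polynomial W_n(s) whose degree grows at most linearly in n.  Write
a = |sigma| and b = |tau|.  The coefficient of s^m in W_n is, for n >= m, the
coefficient of x^n in

    Q_m(x) = sum over a i + b j = m of g_ij x^i h(x)^j,

a polynomial expression in x and h.  Since g depends on y, some m makes
Q_m genuinely involve h.  The proof shows that Q_m converges, so that h is a
root of a nonconstant polynomial over the ring of convergent series, and that
such a root converges.

Convergence of Q_m is a matter of capacity.  On E the values |W_n(s)| are at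
most C_s^n, with C_s depending on s.  Positive capacity provides a probability
measure mu on a bounded part of E whose logarithmic potential is bounded above;
by countable additivity one set B with mu(B) > 0 has a common C_s for all of
its points.  A bound for a polynomial on B controls all of its coefficients,
with a loss exponential in the degree ([coef_le_of_bounded]).  Instead of the
maximum principle behind the Bernstein-Walsh inequality, this uses the
factorization of the polynomial over its roots z: the potentials of mu being
bounded, the average over B of sum_z log ((1 + |z|) / |z - w|) is at most linear
in the number of roots, so at some w in B the product of the |z - w| is not
much smaller than the product of the 1 + |z| ([exists_large_product]), and the
latter product bounds the coefficients.  The resulting bound C^n for all
coefficients of W_n is [polynomial_coefs_bounded].

For the algebraic part ([algebraic_convergent]), passing to derivatives one may
assume that h is a simple root of F.  Expanding F at a truncation of h, as in
Hensel's lemma, turns the equation into z = u + x P(z) for a tail z of h, with u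
and the coefficients of P convergent.  The factor x makes the weighted partial
sums of |z_n| rho^n stay bounded, by induction on their length, once rho is
small ([fixpoint_convergent]). *)

(** * The ring of formal power series *)

(** A name distinct from [nat -> K] keeps the Cauchy product apart from the
pointwise ring structure on functions. *)
Definition fps (K : comNzRingType) : Type := nat -> K.
HB.instance Definition _ (K : comNzRingType) :=
  GRing.Zmodule.copy (fps K) (nat -> K).

Section FpsRing.
Variable K : comNzRingType.
Implicit Types u v w : fps K.

(** Ring identities for the Cauchy product are inherited from polynomials: up to
order n, a series may be replaced by its truncation. *)
Lemma fps_mul_coef u v (p q : {poly K}) n :
    (forall i, (i <= n)%N -> u i = p`_i) -> (forall i, (i <= n)%N -> v i = q`_i) ->
  fps_mul u v n = (p * q)`_n.
Proof.
move=> up vq; rewrite coefM; apply: eq_bigr => i _.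
by rewrite up ?vq ?leq_subr // -ltnS.
Qed.

Definition fps_trunc (n : nat) u : {poly K} := \poly_(i < n.+1) u i.

Lemma coef_fps_trunc n u i : (i <= n)%N -> (fps_trunc n u)`_i = u i.
Proof. by move=> le_in; rewrite coef_poly ltnS le_in. Qed.

Lemma fps_mulE n u v i : (i <= n)%N ->
  fps_mul u v i = (fps_trunc n u * fps_trunc n v)`_i.
Proof.
move=> le_in; apply: fps_mul_coef => j le_ji;
  by rewrite coef_fps_trunc // (leq_trans le_ji).
Qed.

Lemma fps_mulA : associative (@fps_mul K).
Proof.
move=> u v w; apply/funext => n.
rewrite (@fps_mul_coef _ _ (fps_trunc n u) (fps_trunc n v * fps_trunc n w)).
- rewrite mulrA; apply/esym/fps_mul_coef => i le_in; first exact: fps_mulE.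
  by rewrite coef_fps_trunc.
- by move=> i le_in; rewrite coef_fps_trunc.
- by move=> i; exact: fps_mulE.
Qed.

Lemma fps_mulC : commutative (@fps_mul K).
Proof. by move=> u v; apply/funext => n; rewrite !(@fps_mulE n) // mulrC. Qed.

Lemma fps_mul1 : left_id (@fps_one K) (@fps_mul K).
Proof.
move=> u; apply/funext => n.
rewrite (@fps_mul_coef _ _ 1 (fps_trunc n u)) ?mul1r ?coef_fps_trunc //.
  by move=> i _; rewrite coef1.
by move=> i le_in; rewrite coef_fps_trunc.
Qed.

Lemma fps_mulDl : left_distributive (@fps_mul K) (@GRing.add (fps K)).
Proof.
move=> u v w; apply/funext => n; rewrite [RHS]/GRing.add /= /fps_mul -big_split /=.
by apply: eq_bigr => i _; rewrite -mulrDl.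
Qed.

Lemma fps_one_neq0 : @fps_one K != 0 :> fps K.
Proof. by apply/eqP => /(congr1 (fun u => u 0%N)) /eqP; rewrite oner_eq0. Qed.

HB.instance Definition _ := GRing.Zmodule_isComNzRing.Build (fps K)
  fps_mulA fps_mulC fps_mul1 fps_mulDl fps_one_neq0.

Lemma coef_fpsM u v n : (u * v) n = \sum_(i < n.+1) u i * v (n - i)%N.
Proof. by []. Qed.

Lemma coef_fpsD u v n : (u + v) n = u n + v n.
Proof. by []. Qed.

Lemma coef_fpsN u n : (- u) n = - u n.
Proof. by []. Qed.

Lemma coef_fpsMn u k n : (u *+ k) n = u n *+ k.
Proof. by elim: k => // k IHk; rewrite !mulrS coef_fpsD IHk. Qed.

Lemma coef_fps_sum (I : Type) (s : seq I) (P : pred I) (f : I -> fps K) n :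
  (\sum_(i <- s | P i) f i) n = \sum_(i <- s | P i) f i n.
Proof. by elim/big_rec2: _ => // i _ u _ <-. Qed.

Lemma fps_expE (u : fps K) k : fps_exp u k = u ^+ k.
Proof. by elim: k => // k IHk; rewrite exprS -IHk. Qed.

Definition fps_const (c : K) : fps K := fun n => if n is 0%N then c else 0.

Lemma coef_fps_constM c u n : (fps_const c * u) n = c * u n.
Proof.
by rewrite coef_fpsM big_ord_recl big1 /= ?subn0 ?addr0 // => i _; rewrite mul0r.
Qed.

Notation X := (fps_X : fps K).

Lemma coef_fps_XnM k u n : (X ^+ k * u) n = if (k <= n)%N then u (n - k)%N else 0.
Proof.
elim: k n => [|k IHk] n; first by rewrite expr0 mul1r subn0.
rewrite exprS -mulrA coef_fpsM.
case: n => [|n]; first by rewrite big_ord1 /fps_X mul0r.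
rewrite big_ord_recl {1}/fps_X mul0r add0r big_ord_recl {1}/fps_X mul1r.
rewrite big1 ?addr0 => [|i _]; last by rewrite /fps_X mul0r.
by rewrite /= subn1 IHk subSS.
Qed.

Lemma fps_XnM_inj k : injective (fun u => X ^+ k * u).
Proof.
move=> u v uv; apply/funext => n; move/(congr1 (fun w => w (n + k)%N)): uv.
by rewrite !coef_fps_XnM leq_addl addnK.
Qed.

Definition fps_shift (k : nat) u : fps K := fun n => u (n + k)%N.

Lemma fps_shiftK k u : (forall i, (i < k)%N -> u i = 0) -> X ^+ k * fps_shift k u = u.
Proof.
move=> u0; apply/funext => n; rewrite coef_fps_XnM /fps_shift.
by case: leqP => [le_kn|/u0 //]; rewrite subnK.
Qed.

Definition fps_low (k : nat) u : fps K := fun n => if (n < k)%N then u n else 0.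

Lemma fps_split k u : u = fps_low k u + X ^+ k * fps_shift k u.
Proof.
apply/funext => n; rewrite coef_fpsD coef_fps_XnM /fps_shift /fps_low.
by case: ltnP => [_|le_kn]; rewrite ?addr0 // add0r subnK.
Qed.

End FpsRing.
Arguments fps_const {K}.

(** * Taylor expansion of polynomials to second order *)

Section Taylor.
Variable A : comNzRingType.
Implicit Types (p : {poly A}) (a b : A).

Lemma horner_addr1 p a b : exists v, p.[a + b] = p.[a] + b * v.
Proof.
elim/poly_ind: p => [|p c [v IHp]]; first by exists 0; rewrite !horner0 mulr0 addr0.
exists (p.[a] + v * (a + b)); rewrite !hornerE IHp; ring.
Qed.

Definition taylor2_rem p a : {poly A} := \sum_(i < size p) p^`N(i.+2).[a] *: 'X^i.

Lemma taylor2 p a b :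
  p.[a + b] = p.[a] + p^`().[a] * b + b ^+ 2 * (taylor2_rem p a).[b].
Proof.
rewrite nderiv_taylor; last exact: mulrC.
transitivity (\sum_(i < (size p).+2) p^`N(i).[a] * b ^+ i).
  rewrite (big_ord_widen _ (fun i => p^`N(i).[a] * b ^+ i)
    (leq_trans (leqnSn _) (leqnSn _))).
  rewrite big_mkcond; apply: eq_bigr => i _; case: ltnP => // le_pi.
  by rewrite nderivn_poly0 // horner0 mul0r.
rewrite !big_ord_recl /= nderivn0 expr0 mulr1 nderivn1 expr1 addrA; congr (_ + _).
rewrite horner_sum mulr_sumr; apply: eq_bigr => i _.
by rewrite hornerZ hornerXn (mulrCA (b ^+ 2)) -(exprD b 2 i).
Qed.

End Taylor.

(** * Weighted partial sums and convergence *)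

Section Modulus.
Variable R : realType.
Implicit Types (x y z : R[i]).

Lemma modCE z : modC z = ComplexField.Normc.normc z.
Proof. by []. Qed.

Lemma modC_norm z : `|z| = (modC z)%:C%C.
Proof. by []. Qed.

Lemma modC_ge0 z : 0 <= modC z.
Proof. by rewrite -lecR -modC_norm normr_ge0. Qed.

Lemma modCM x y : modC (x * y) = modC x * modC y.
Proof. by rewrite !modCE ComplexField.Normc.normcM. Qed.

Lemma modC_leD x y : modC (x + y) <= modC x + modC y.
Proof. by rewrite -lecR rmorphD /= -!modC_norm ler_normD. Qed.

Lemma modCN x : modC (- x) = modC x.
Proof. by rewrite /modC normrN. Qed.

Lemma modC0 : modC (0 : R[i]) = 0.
Proof. by rewrite /modC normr0. Qed.

Lemma modC1 : modC (1 : R[i]) = 1.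
Proof. by rewrite /modC normr1. Qed.

Lemma modC_eq0 z : (modC z == 0) = (z == 0).
Proof. by rewrite -(normr_eq0 z) modC_norm -(inj_eq (@complexI R)). Qed.

Lemma modCX z n : modC (z ^+ n) = modC z ^+ n.
Proof. by elim: n => [|n IHn]; rewrite ?expr0 ?modC1 // !exprS modCM IHn. Qed.

Lemma modC_lesum (I : Type) (s : seq I) (P : pred I) (f : I -> R[i]) :
  modC (\sum_(i <- s | P i) f i) <= \sum_(i <- s | P i) modC (f i).
Proof.
elim/big_rec2: _ => [|i x y _ le_yx]; first by rewrite modC0.
by rewrite (le_trans (modC_leD _ _)) // lerD2l.
Qed.

Lemma modC_prod (I : Type) (s : seq I) (f : I -> R[i]) :
  modC (\prod_(i <- s) f i) = \prod_(i <- s) modC (f i).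
Proof. by elim/big_rec2: _ => [|i x y _ <-]; rewrite ?modC1 ?modCM. Qed.

End Modulus.

Section Convergence.
Variable R : realType.
Implicit Types (u v w : fps R[i]) (rho : R).

Definition wnorm rho (N : nat) u : R := \sum_(i < N) modC (u i) * rho ^+ i.

Lemma wnormS rho N u : wnorm rho N.+1 u = wnorm rho N u + modC (u N) * rho ^+ N.
Proof. exact: big_ord_recr. Qed.

Lemma wnorm_ge0 rho N u : 0 <= rho -> 0 <= wnorm rho N u.
Proof. by move=> r0; apply: sumr_ge0 => i _; rewrite mulr_ge0 ?modC_ge0 ?exprn_ge0. Qed.

Lemma wnorm_leD rho N u v : 0 <= rho ->
  wnorm rho N (u + v) <= wnorm rho N u + wnorm rho N v.
Proof.
move=> r0; rewrite -big_split /=; apply: ler_sum => i _.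
by rewrite -mulrDl ler_wpM2r ?exprn_ge0 // modC_leD.
Qed.

Lemma wnormN rho N u : wnorm rho N (- u) = wnorm rho N u.
Proof. by apply: eq_bigr => i _; rewrite coef_fpsN modCN. Qed.

(** Partial sums of a Cauchy product are dominated by products of partial sums;
evaluating at 1 the product of the two polynomials of weighted moduli spares the
reindexing of double sums. *)
Lemma wnorm_leM rho N u v : 0 <= rho ->
  wnorm rho N (u * v) <= wnorm rho N u * wnorm rho N v.
Proof.
move=> r0; pose p w : {poly R} := \poly_(i < N) (modC (w i) * rho ^+ i).
have p_ge0 w i : 0 <= (p w)`_i.
  by rewrite coef_poly; case: ifP; rewrite // mulr_ge0 ?modC_ge0 ?exprn_ge0.
have wnormE w : wnorm rho N w = (p w).[1].
  by rewrite horner_poly; apply: eq_bigr => i _; rewrite expr1n mulr1.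
have pq_ge0 i : 0 <= (p u * p v)`_i.
  by rewrite coefM sumr_ge0 // => j _; rewrite mulr_ge0.
rewrite [leRHS](_ : _ = (p u * p v).[1]); last by rewrite hornerM -!wnormE.
pose M := maxn N (size (p u * p v)).
rewrite (@horner_coef_wide _ M) ?leq_maxr //.
rewrite (eq_bigr (fun i : 'I_M => (p u * p v)`_i)); last first.
  by move=> i _; rewrite expr1n mulr1.
apply: (@le_trans _ _ (\sum_(i < N) (p u * p v)`_i)); last first.
  rewrite (big_ord_widen _ _ (leq_maxl N (size (p u * p v)))) big_mkcond /=.
  by apply: ler_sum => i _; case: ifP.
apply: ler_sum => i _; rewrite coefM coef_fpsM.
apply: (@le_trans _ _ ((\sum_(j < i.+1) modC (u j * v (i - j)%N)) * rho ^+ i)).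
  by rewrite ler_wpM2r ?exprn_ge0 // modC_lesum.
rewrite mulr_suml le_eqVlt; apply/orP; left; apply/eqP/eq_bigr => j _.
have ji : (j <= i)%N by rewrite -ltnS.
rewrite !coef_poly (leq_ltn_trans ji) ?(leq_ltn_trans (leq_subr _ _)) //.
have -> : rho ^+ i = rho ^+ (i - j) * rho ^+ j by rewrite -exprD subnK.
by rewrite modCM; ring.
Qed.

Lemma wnorm_mono rho rho' N u : 0 <= rho -> rho <= rho' ->
  wnorm rho N u <= wnorm rho' N u.
Proof.
move=> r0 rr'; apply: ler_sum => i _; rewrite ler_wpM2l ?modC_ge0 //.
by rewrite lerXn2r // nnegrE // (le_trans r0).
Qed.

Definition wbounded rho u := exists B : R, forall N, wnorm rho N u <= B.

Lemma wboundedD rho u v : 0 <= rho -> wbounded rho u -> wbounded rho v ->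
  wbounded rho (u + v).
Proof.
move=> r0 [B uB] [C vC]; exists (B + C) => N.
by rewrite (le_trans (wnorm_leD _ _ _ r0)) // lerD.
Qed.

Lemma wboundedM rho u v : 0 <= rho -> wbounded rho u -> wbounded rho v ->
  wbounded rho (u * v).
Proof.
move=> r0 [B uB] [C vC]; exists (B * C) => N.
by rewrite (le_trans (wnorm_leM _ _ _ r0)) // ler_pM ?wnorm_ge0.
Qed.

Lemma wbounded_mono rho rho' u : 0 <= rho -> rho <= rho' ->
  wbounded rho' u -> wbounded rho u.
Proof.
by move=> r0 rr' [B uB]; exists B => N; rewrite (le_trans (wnorm_mono _ _ r0 rr')).
Qed.

(** Geometric growth of the coefficients amounts to boundedness of the weighted
sums for one radius, a condition preserved by shrinking the radius and by ring
operations. *)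
Lemma fps_convergentP u :
  fps_convergent u <-> exists2 rho : R, 0 < rho & wbounded rho u.
Proof.
split=> [[C uC]|[rho rho0 [B uB]]].
- pose D := `|C| + 1.
  have D1 : 1 <= D by rewrite lerDr.
  have D0 : 0 < D by rewrite (lt_le_trans _ D1).
  have uD k : (0 < k)%N -> modC (u k) <= D ^+ k.
    move=> k0; rewrite (le_trans (uC k k0)) // (le_trans (ler_norm _)) // normrX.
    by rewrite lerXn2r ?nnegrE ?(ltW D0) // lerDl.
  (* With this radius the n-th term is at most 2^-n for n > 0. *)
  exists (2 * D)^-1; first by rewrite invr_gt0 mulr_gt0.
  have uS N : wnorm (2 * D)^-1 N.+1 u <= modC (u 0%N) + 1 - (2^-1) ^+ N.
    elim: N => [|N IHN]; first by rewrite /wnorm big_ord1 !expr0; lra.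
    have le_pow : modC (u N.+1) * (2 * D)^-1 ^+ N.+1 <= 2^-1 ^+ N.+1.
      rewrite invfM exprMn mulrCA ler_piMr ?exprn_ge0 //.
      by rewrite exprVn ler_pdivrMr ?exprn_gt0 // mul1r uD.
    rewrite wnormS; move: IHN le_pow; rewrite [2^-1 ^+ N.+1]exprS.
    set x := 2^-1 ^+ N; lra.
  exists (modC (u 0%N) + 1) => -[|N].
    by rewrite /wnorm big_ord0 addr_ge0 ?modC_ge0.
  by rewrite (le_trans (uS N)) // gerBl exprn_ge0.
- have B0 : 0 <= B by apply: le_trans (uB 0%N); rewrite /wnorm big_ord0.
  exists ((B + 1) / rho) => -[//|k] _.
  rewrite expr_div_n ler_pdivlMr ?exprn_gt0 //.
  have := uB k.+2; rewrite wnormS => uBk.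
  apply: (@le_trans _ _ B).
    by apply: le_trans uBk; rewrite lerDr wnorm_ge0 // ltW.
  rewrite exprS (@le_trans _ _ (B + 1)) ?lerDl // ler_peMr ?addr_ge0 //.
  by rewrite exprn_ege1 // lerDr.
Qed.

End Convergence.

(** * Algebraic power series converge *)

Section ConvergentSeries.
Variable R : realType.
Notation fpsC := (fps R[i]).
Notation X := (fps_X : fpsC).
Implicit Types (u v z : fpsC) (P F : {poly fpsC}).

Definition convergent_fps : {pred fpsC} := fun u => `[< fps_convergent u >].

Lemma convergent_fpsP u : reflect (fps_convergent u) (u \in convergent_fps).
Proof. exact: asboolP. Qed.

Lemma convergent_fps_fin N u : (forall n, (N <= n)%N -> u n = 0) ->
  u \in convergent_fps.
Proof.
move=> u0; apply/convergent_fpsP/fps_convergentP; exists 1 => //.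
exists (\sum_(i < N) modC (u i)) => M; rewrite /wnorm.
rewrite (eq_bigr (fun i : 'I_M => modC (u i))); last first.
  by move=> i _; rewrite expr1n mulr1.
have [le_MN|/ltnW le_NM] := leqP M N.
  rewrite (big_ord_widen _ (fun i => modC (u i)) le_MN) big_mkcond /=.
  by apply: ler_sum => i _; case: ifP; rewrite ?modC_ge0.
rewrite [leRHS](big_ord_widen _ (fun i => modC (u i)) le_NM) [leRHS]big_mkcond /=.
by apply: ler_sum => i _; case: ltnP => // /u0->; rewrite modC0.
Qed.

Lemma convergent_fps_const c : fps_const c \in convergent_fps.
Proof. by apply: (@convergent_fps_fin 1) => -[]. Qed.

Lemma convergent_fps_X : X \in convergent_fps.
Proof. by apply: (@convergent_fps_fin 2) => -[|[]]. Qed.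

Lemma convergent_fps_low k u : fps_low k u \in convergent_fps.
Proof. by apply: (@convergent_fps_fin k) => n; rewrite /fps_low ltnNge => ->. Qed.

Lemma convergent_fps_subring : subring_closed convergent_fps.
Proof.
have cvg2 u v (Q : fpsC) :
    (forall rho : R, 0 < rho -> wbounded rho u -> wbounded rho v -> wbounded rho Q) ->
    u \in convergent_fps -> v \in convergent_fps -> Q \in convergent_fps.
  move=> uvQ /convergent_fpsP/fps_convergentP[r r0 ur].
  move=> /convergent_fpsP/fps_convergentP[s s0 vs].
  have m0 : 0 < Num.min r s by rewrite lt_min r0.
  apply/convergent_fpsP/fps_convergentP; exists (Num.min r s) => //.
  apply: uvQ => //; first by apply: (wbounded_mono (ltW m0)) ur; rewrite ge_min lexx.
  by apply: (wbounded_mono (ltW m0)) vs; rewrite ge_min lexx orbT.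
split=> [|u v|u v].
- by apply: (@convergent_fps_fin 1) => -[].
- apply: cvg2 => rho rho0 bu [B vB]; apply: (wboundedD (ltW rho0)) => //.
  by exists B => N; rewrite wnormN.
- by apply: cvg2 => rho rho0; apply: wboundedM; apply: ltW.
Qed.

HB.instance Definition _ := GRing.isSubringClosed.Build fpsC convergent_fps
  convergent_fps_subring.

Lemma convergent_fps_shift k u :
  (fps_shift k u \in convergent_fps) = (u \in convergent_fps).
Proof.
apply/idP/idP => [cu|].
  rewrite (fps_split k u) rpredD ?convergent_fps_low // rpredM ?rpredX //.
  exact: convergent_fps_X.
move=> /convergent_fpsP/fps_convergentP[r r0 [B uB]].
apply/convergent_fpsP/fps_convergentP; exists r => //.
exists (B / r ^+ k) => N; rewrite ler_pdivlMr ?exprn_gt0 //.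
apply: le_trans (uB (N + k)%N); rewrite addnC /wnorm big_split_ord /= mulr_suml.
rewrite -[leLHS]add0r lerD ?(wnorm_ge0 _ _ (ltW r0)) //.
by apply: ler_sum => i _; rewrite /fps_shift addnC exprD -mulrA (mulrC (r ^+ k)).
Qed.

(** The factor X delays P.[z] by one order and scales it by the radius t, so the
partial sum of z of length N+1 is controlled by the one of length N.  For t small
the bound B + 1 reproduces itself, B bounding u and the coefficients of P. *)
Lemma fixpoint_convergent P u z : P \is a polyOver convergent_fps ->
  u \in convergent_fps -> z = u + X * P.[z] -> z \in convergent_fps.
Proof.
move=> /polyOverP Pc uc zE.
(* A common radius and a common bound for u and for all coefficients of P. *)
have [r r0 [B [uB PB]]] : exists2 r : R, 0 < r & exists B : R,
    (forall N, wnorm r N u <= B) /\ (forall i N, (i < size P)%N -> wnorm r N P`_i <= B).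
  elim: (size P) => [|n [r r0 [B [uB PB]]]].
    move/convergent_fpsP/fps_convergentP: uc => [r r0 [B uB]].
    by exists r => //; exists B.
  have /convergent_fpsP/fps_convergentP[s s0 [C PC]] := Pc n.
  have m0 : 0 < Num.min r s by rewrite lt_min r0.
  have mr : Num.min r s <= r by rewrite ge_min lexx.
  have ms : Num.min r s <= s by rewrite ge_min lexx orbT.
  exists (Num.min r s) => //; exists (Num.max B C); split=> [N|i N].
    by rewrite (le_trans (wnorm_mono _ _ (ltW m0) mr)) // le_max uB.
  rewrite ltnS leq_eqVlt => /predU1P[->|lt_in].
    by rewrite (le_trans (wnorm_mono _ _ (ltW m0) ms)) // le_max PC orbT.
  by rewrite (le_trans (wnorm_mono _ _ (ltW m0) mr)) // le_max PB.
have B0 : 0 <= B by rewrite (le_trans _ (uB 0%N)) // /wnorm big_ord0.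
pose S := \sum_(i < size P) B * (B + 1) ^+ i.
have S0 : 0 <= S by apply: sumr_ge0 => i _; rewrite mulr_ge0 ?exprn_ge0 ?addr_ge0.
pose t := Num.min r (S + 1)^-1.
have t0 : 0 < t by rewrite lt_min r0 invr_gt0 ltr_wpDl.
have tr : t <= r by rewrite ge_min lexx.
have tS : t * S <= 1.
  apply: (@le_trans _ _ ((S + 1)^-1 * S)).
    by rewrite ler_wpM2r // ge_min lexx orbT.
  by rewrite mulrC ler_pdivrMr ?ltr_wpDl // mul1r lerDl.
have wX N v : wnorm t N.+1 (X * v) = t * wnorm t N v.
  rewrite /wnorm big_ord_recl -(expr1 X) coef_fps_XnM /= modC0 mul0r add0r mulr_sumr.
  by apply: eq_bigr => i _; rewrite coef_fps_XnM /= subn1 exprS; ring.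
apply/convergent_fpsP/fps_convergentP; exists t => //; exists (B + 1).
have wP N : wnorm t N z <= B + 1 -> wnorm t N P.[z] <= S.
  move=> zB; rewrite horner_coef.
  have wsum (I : Type) (s : seq I) (f : I -> fpsC) :
      wnorm t N (\sum_(i <- s) f i) <= \sum_(i <- s) wnorm t N (f i).
    elim/big_rec2: _ => [|i x y _ le_yx].
      by rewrite /wnorm big1 // => i _; rewrite modC0 mul0r.
    by rewrite (le_trans (wnorm_leD _ _ _ (ltW t0))) // lerD2l.
  apply: (le_trans (wsum _ _ _)); apply: ler_sum => i _.
  apply: (le_trans (wnorm_leM _ _ _ (ltW t0))); apply: ler_pM.
  - exact: wnorm_ge0 (ltW t0).
  - exact: wnorm_ge0 (ltW t0).
  - by rewrite (le_trans (wnorm_mono _ _ (ltW t0) tr)) // PB.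
  elim: (nat_of_ord i) => [|k IHk].
    case: (N) => [|M]; first by rewrite /wnorm big_ord0.
    rewrite /wnorm big_ord_recl modC1 mulr1 big1 ?addr0 // => j _.
    by rewrite modC0 mul0r.
  rewrite !exprS (le_trans (wnorm_leM _ _ _ (ltW t0))) //.
  by rewrite ler_pM ?wnorm_ge0 // ltW.
elim=> [|N IHN]; first by rewrite /wnorm big_ord0 addr_ge0.
rewrite zE (le_trans (wnorm_leD _ _ _ (ltW t0))) // lerD //.
  by rewrite (le_trans (wnorm_mono _ _ (ltW t0) tr)).
by rewrite wX (le_trans _ tS) // ler_wpM2l ?wP // ltW.
Qed.

(** Newton's method: let r be the order of F'(u) and cut u after degree r, so that
u = a + X^(r+1) z.  In the Taylor expansion of F at a the linear term is
X^(2r+1) b z with b(0) nonzero and the quadratic remainder is divisible by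
X^(2r+2).  Hence F(a) is divisible by X^(2r+1), and after division the equation has
the form solved by [fixpoint_convergent]. *)
Lemma simple_root_convergent F u : F \is a polyOver convergent_fps ->
  F.[u] = 0 -> F^`().[u] != 0 -> u \in convergent_fps.
Proof.
move=> Fc Fu0 dFu.
have [r [dFur dFu0]] : exists r, F^`().[u] r != 0 /\
    forall i, (i < r)%N -> F^`().[u] i = 0.
  have ex_r : exists r, F^`().[u] r != 0.
    apply: contrapT => no_r; case/eqP: dFu; apply/funext => n.
    by apply/eqP/negPn/negP => nz; apply: no_r; exists n.
  exists (ex_minn ex_r); case: ex_minnP => m nz min_m; split=> // i.
  by rewrite ltnNge => /negP im; apply/eqP/negPn/negP => /min_m.
pose a := fps_low r.+1 u; pose z := fps_shift r.+1 u.
have uE : u = a + X ^+ r.+1 * z by exact: fps_split.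
have ac : a \in convergent_fps by exact: convergent_fps_low.
have Xc : X \in convergent_fps by exact: convergent_fps_X.
have dFc : F^`() \is a polyOver convergent_fps by exact: polyOver_deriv.
have dFa i : (i <= r)%N -> F^`().[a] i = F^`().[u] i.
  move=> le_ir; have [v] := horner_addr1 F^`() a (X ^+ r.+1 * z).
  rewrite -uE => ->; rewrite coef_fpsD -mulrA coef_fps_XnM.
  by rewrite leqNgt ltnS le_ir addr0.
pose b := fps_shift r F^`().[a].
have dFaE : F^`().[a] = X ^+ r * b.
  by rewrite fps_shiftK // => i lt_ir; rewrite dFa ?dFu0 // ltnW.
have bc : b \in convergent_fps by rewrite convergent_fps_shift rpred_horner.
have b0 : b 0%N != 0 by rewrite /b /fps_shift add0n dFa.
pose Q := taylor2_rem F a.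
have Qc : Q \is a polyOver convergent_fps.
  apply: rpred_sum => i _; apply: polyOverZ; last exact: rpredX (polyOverX _).
  by apply: rpred_horner => //; apply: polyOver_nderivn.
have taylor := taylor2 F a (X ^+ r.+1 * z); rewrite -uE Fu0 dFaE -/Q in taylor.
pose q := z ^+ 2 * Q.[X ^+ r.+1 * z].
have FaE : F.[a] = X ^+ (r + r.+1) * (- (b * z) - X * q).
  move/esym/eqP: taylor; rewrite -addrA addr_eq0 => /eqP->.
  by rewrite /q exprD exprS; ring.
pose c := fps_shift (r + r.+1) F.[a].
have cc : c \in convergent_fps by rewrite convergent_fps_shift rpred_horner.
have cE : c = - (b * z) - X * q.
  apply: (@fps_XnM_inj _ (r + r.+1)); rewrite -FaE fps_shiftK // => i lt_i.
  by rewrite FaE coef_fps_XnM leqNgt lt_i.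
(* Only the constant term of b is inverted; the rest of b goes into X * P. *)
pose d := fps_shift 1 b; pose k : fpsC := fps_const (b 0%N)^-1.
have kb : k * b = 1 + X * (k * d).
  rewrite [in LHS](fps_split 1 b) expr1 -/d mulrDr; congr (_ + _); last by ring.
  apply/funext => -[|n]; rewrite coef_fps_constM /fps_low /= ?mulr0 //.
  by rewrite mulVf.
have kc : k \in convergent_fps by exact: convergent_fps_const.
pose P := (- k)%:P * (d%:P * 'X + 'X^2 * (Q \Po ((X ^+ r.+1)%:P * 'X))).
have Pc : P \is a polyOver convergent_fps.
  have dc : d \in convergent_fps by rewrite convergent_fps_shift.
  by rewrite !(rpredM, rpredD, polyOverC, polyOverX, rpredX, rpredN, polyOver_comp).
have zE : z = - (k * c) + X * P.[z].
  have bz : b * z = - c - X * q by rewrite cE; ring.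
  transitivity (k * (b * z) - X * (k * d) * z); first by rewrite mulrA kb; ring.
  rewrite bz /P !(hornerM, hornerD) horner_comp.
  by rewrite !(hornerM, hornerC, hornerXn, hornerX) /q; ring.
suff zc : z \in convergent_fps by rewrite uE rpredD // rpredM ?rpredX.
by apply: fixpoint_convergent zE => //; rewrite rpredN rpredM.
Qed.

End ConvergentSeries.

(** * Truncated logarithmic kernels *)

Section LogKernel.
Variable R : realType.
Implicit Types (z w : R[i]) (N : nat).
Notation T := (borelC R).

Lemma closed_measurableC (F : set R[i]) : @closed R[i]^o F -> measurable (F : set T).
Proof.
move=> /closed_openC oF; rewrite -[F]setCK; apply: measurableC.
exact: sub_sigma_algebra.
Qed.

Lemma measurable_modC_sub z : measurable_fun [set: T] (fun w : T => modC (z - w)).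
Proof.
apply: (measurability _ (RGenOInfty.measurableE R)) => // _ [_ [x ->] <-].
rewrite setTI; apply: sub_sigma_algebra; rewrite /= openE => w /=.
rewrite in_itv /= andbT => xw; apply/nbhs_ballP.
exists (modC (z - w) - x)%:C%C => /=; first by rewrite ltcR subr_gt0.
move=> y; rewrite -ball_normE /= modC_norm ltcR in_itv /= andbT => ywd.
have := modC_leD (z - y) (y - w); rewrite addrA subrK.
have -> : modC (y - w) = modC (w - y) by rewrite -modCN opprB.
move=> le_zw; lra.
Qed.

(** The truncation min (N, log (1/|z - w|)), written so that it is real-valued and
continuous also at w = z. *)
Definition trunc_kernel N z w : R := - ln (Num.max (modC (z - w)) (expR (- N%:R))).

Lemma trunc_kernelE N z w :
  mine N%:R%:E (log_kernel z w) = (trunc_kernel N z w)%:E.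
Proof.
rewrite /log_kernel /trunc_kernel; have := modC_ge0 (z - w).
rewrite le_eqVlt => /predU1P[<-|m_gt0].
  by rewrite le0_lneNy // max_r ?expR_ge0 // expRK opprK; apply/min_idPl; rewrite leey.
rewrite lne_EFin // -EFinN -EFin_min; congr (_%:E).
have [le_m|lt_m] := leP (modC (z - w)) (expR (- N%:R)).
  rewrite expRK opprK; apply/min_idPl.
  by rewrite lerNr -[leRHS]expRK ler_ln ?posrE ?expR_gt0.
apply/min_idPr; rewrite lerNl -[leLHS]expRK ler_ln ?posrE ?expR_gt0 //.
exact: ltW.
Qed.

Lemma measurable_trunc_kernel N z : measurable_fun [set: T] (trunc_kernel N z).
Proof.
apply: measurableT_comp => //; apply: measurableT_comp; first exact: measurable_ln.
by apply: measurable_maxr => //; exact: measurable_modC_sub.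
Qed.

Lemma trunc_kernel_le N z w : trunc_kernel N z w <= N%:R.
Proof. by rewrite -lee_fin -trunc_kernelE ge_min lexx. Qed.

Lemma trunc_kernel_mono N N' z w : (N <= N')%N ->
  trunc_kernel N z w <= trunc_kernel N' z w.
Proof.
move=> NN'; rewrite -lee_fin -!trunc_kernelE le_min ge_min lee_fin ler_nat NN' /=.
by rewrite ge_min lexx orbT.
Qed.

Lemma trunc_kernel_ge N z w (a : R) : 1 <= a -> modC (z - w) <= a ->
  - ln a <= trunc_kernel N z w.
Proof.
move=> a1 za; have a0 : 0 < a by exact: lt_le_trans a1.
rewrite lerN2 ler_ln ?posrE // ?lt_max ?expR_gt0 ?orbT // ge_max za /=.
by rewrite (le_trans _ a1) // -expR0 ler_expR oppr_le0.
Qed.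

Lemma trunc_kernel_modC N z w : trunc_kernel N z w < N%:R ->
  0 < modC (z - w) /\ trunc_kernel N z w = - ln (modC (z - w)).
Proof.
rewrite /trunc_kernel.
case: (leP (modC (z - w)) (expR (- N%:R))) => [_|lt_m _].
  by rewrite expRK opprK ltxx.
by split=> //; exact: lt_trans (expR_gt0 _) lt_m.
Qed.

Lemma trunc_kernel_le_ln N z w : 0 < modC (z - w) ->
  trunc_kernel N z w <= - ln (modC (z - w)).
Proof.
by move=> m0; rewrite lerN2 ler_ln ?posrE // ?lt_max ?m0 // le_max lexx.
Qed.

End LogKernel.

(** * Measures with bounded logarithmic potential *)

Section BoundedPotential.
Variables (R : realType) (mu : probability (borelC R) R) (A : set (borelC R)) (r M : R).
Hypotheses (mA : measurable A) (muA : mu A = 1%E) (r0 : 0 <= r).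
Hypothesis A_r : forall w : R[i], A w -> modC w <= r.
Hypothesis muM : forall z : R[i], (log_potential mu z <= M%:E)%E.
Implicit Types (z w : R[i]) (N : nat).

Let supp_bound z : R := (1 + r) * (1 + modC z).

Let supp_bound_ge1 z : 1 <= supp_bound z.
Proof. by rewrite /supp_bound; have := modC_ge0 z; move: r0; nra. Qed.

Let modC_sub_le z w : A w -> modC (z - w) <= supp_bound z.
Proof.
move=> /A_r wr; have := modC_leD z (- w); rewrite modCN /supp_bound.
by have := modC_ge0 z; have := modC_ge0 w; move: r0; nra.
Qed.

Let integrable_kernel N z : mu.-integrable A (EFin \o trunc_kernel N z).
Proof.
apply: measurable_bounded_integrable => //.
- by rewrite (le_lt_trans (probability_le1 _ _)) ?ltry.
- by apply: measurable_funTS; exact: measurable_trunc_kernel.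
exists (N%:R + ln (supp_bound z)); split; first exact: num_real.
move=> K ltK w /= Aw; rewrite ler_norml; apply/andP; split.
  have := trunc_kernel_ge N (supp_bound_ge1 z) (modC_sub_le z Aw).
  by have : 0 <= N%:R :> R by []; lra.
by have := trunc_kernel_le N z w; have := ln_ge0 (supp_bound_ge1 z); lra.
Qed.

(** The complement of A is null, and on the bounded set A the truncated kernel is
bounded. *)
Let integral_kernel N z :
  (\int[mu]_w mine N%:R%:E (log_kernel z w) =
   \int[mu]_(w in A) (trunc_kernel N z w)%:E)%E.
Proof.
under eq_integral do rewrite trunc_kernelE.
have mk D : measurable_fun D (EFin \o trunc_kernel N z : borelC R -> \bar R).
  by apply: measurable_funTS; apply: measurableT_comp => //; exact: measurable_trunc_kernel.
rewrite -(setUv A) integral_setU //; last 2 first.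
- exact: measurableC.
- by apply/disj_setPS; rewrite setICr.
rewrite [X in (_ + X)%E](_ : _ = 0%E) ?adde0 //.
rewrite (ae_eq_integral (cst 0%E)) //; last 2 first.
- exact: measurableC.
- exists (~` A); split; [exact: measurableC| |by move=> w /= /not_implyP[]].
  by apply: (etrans (probability_setC mu mA)); rewrite muA subee.
by rewrite integral_cst ?mul0e //; exact: measurableC.
Qed.

(** The truncated integrals increase with N, so each is below their limit, which is
the potential. *)
Lemma integral_trunc_kernel_le N z :
  (\int[mu]_(w in A) (trunc_kernel N z w)%:E <= M%:E)%E.
Proof.
rewrite -integral_kernel; apply: le_trans (muM z); rewrite /log_potential.
set I := (fun n : nat => _).
have ndI : {homo I : n m / (n <= m)%N >-> (n <= m)%E}.
  move=> n m le_nm; rewrite /I !integral_kernel.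
  apply: le_integral => //; [exact: integrable_kernel..|] => w _.
  by rewrite lee_fin trunc_kernel_mono.
by rewrite (cvg_lim _ (ereal_nondecreasing_cvgn ndI)) //;
  apply: ereal_sup_ubound; exists N.
Qed.

(** log ((1 + r) (1 + |z|) / |z - w|), truncated: a translate of the kernel that is
nonnegative for w in A and takes the size of z into account. *)
Definition shifted_kernel N z w : R := ln (supp_bound z) + trunc_kernel N z w.

Lemma shifted_kernel_ge0 N z w : A w -> 0 <= shifted_kernel N z w.
Proof.
move=> Aw; have := trunc_kernel_ge N (supp_bound_ge1 z) (modC_sub_le z Aw).
by rewrite /shifted_kernel; lra.
Qed.

Lemma measurable_shifted_kernel N z D :
  measurable_fun D (fun w : borelC R => (shifted_kernel N z w)%:E).
Proof.
apply: measurable_funTS; apply: measurableT_comp => //; apply: measurable_funD => //.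
exact: measurable_trunc_kernel.
Qed.

Definition shifted_bound : R := `|M| + ln ((1 + r) * (2 + 2 * r)).

Lemma shifted_bound_ge0 : 0 <= shifted_bound.
Proof. by rewrite addr_ge0 // ln_ge0 //; move: r0; nra. Qed.

(** The bound is uniform in z: for z of moderate size it comes from the potential,
and for z far from A the quotient (1 + |z|) / |z - w| is itself bounded. *)
Lemma integral_shifted_kernel_le N z :
  (\int[mu]_(w in A) (shifted_kernel N z w)%:E <= shifted_bound%:E)%E.
Proof.
have [z_small|z_big] := leP (modC z) (2 * r + 1).
  rewrite [leLHS](integralD mA (f1 := cst (ln (supp_bound z))%:E)
    (f2 := EFin \o trunc_kernel N z)); last exact: integrable_kernel.
    rewrite integral_cst // [X in (_ * X)%E](_ : _ = 1%E) ?mule1; last exact: muA.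
    rewrite /shifted_bound EFinD addeC; apply: leeD.
      apply: (le_trans (integral_trunc_kernel_le N z)).
      by rewrite lee_fin ler_norm.
    rewrite lee_fin ler_ln ?posrE; [|exact: lt_le_trans (supp_bound_ge1 z)|].
      by rewrite /supp_bound ler_wpM2l ?addr_ge0 //; lra.
    by move: r0; nra.
  exact: finite_measure_integrable_cst.
apply: (@le_trans _ _ (\int[mu]_(w in A) cst (ln (2 * (1 + r)))%:E w)%E).
  apply: ge0_le_integral => //.
  - by move=> w Aw; rewrite lee_fin shifted_kernel_ge0.
  - exact: measurable_shifted_kernel.
  move=> w Aw; rewrite lee_fin /=.
  have zw : (1 + modC z) / 2 <= modC (z - w).
    have := modC_leD (z - w) w; rewrite subrK; have := A_r Aw; lra.
  have zw0 : 0 < modC (z - w) by have := modC_ge0 z; lra.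
  rewrite /shifted_kernel (le_trans (lerD (lexx _) (trunc_kernel_le_ln N zw0))) //.
  have s0 : 0 < supp_bound z by exact: lt_le_trans (supp_bound_ge1 z).
  rewrite -ln_div ?posrE // ler_ln ?posrE ?divr_gt0 //.
    by rewrite ler_pdivrMr // /supp_bound; move: r0 (modC_ge0 z); nra.
  by move: r0; nra.
rewrite integral_cst // [X in (_ * X)%E](_ : _ = 1%E) ?mule1; last exact: muA.
rewrite lee_fin ler_wpDl //.
by rewrite ler_ln ?posrE; move: r0; nra.
Qed.

(** If the sum over s of the shifted kernels were large at every w in B, its integral
would exceed the sum of the bounds for the individual roots.  This is the substitute
for the Bernstein-Walsh inequality. *)
Lemma exists_large_product (B : set (borelC R)) : measurable B -> B `<=` A ->
    (0 < mu B)%E ->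
  exists2 C : R, 0 <= C & forall s : seq R[i], exists2 w : R[i], B w &
    \prod_(z <- s) (1 + modC z) <= C ^+ (size s).+1 * \prod_(z <- s) modC (z - w).
Proof.
move=> mB BA muB.
have muB_fin : mu B \is a fin_num by exact: fin_num_measure.
pose m := fine (mu B).
have m0 : 0 < m by rewrite fine_gt0 // muB ltey_eq muB_fin.
have mE : mu B = m%:E by rewrite fineK.
exists (expR ((shifted_bound + 1) / m)) => [|s]; first exact: expR_ge0.
pose t := ((size s)%:R * shifted_bound + 1) / m.
have t0 : 0 < t by rewrite divr_gt0 // ltr_wpDl // mulr_ge0 // shifted_bound_ge0.
(* At a point where the sum is below t < N, no summand is truncated. *)
have [N tN] : exists N : nat, t < N%:R.
  by exists (Num.Def.archi_bound t); exact: archi_boundP (ltW t0).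
have [w Bw sum_lt] : exists2 w, B w & \sum_(z <- s) shifted_kernel N z w < t.
  apply: contrapT => no_w.
  have le_t w : B w -> (t%:E <= \sum_(z <- s) (shifted_kernel N z w)%:E)%E.
    move=> Bw; rewrite sumEFin lee_fin leNgt; apply/negP => lt_t.
    by apply: no_w; exists w.
  have : (t%:E * mu B <= ((size s)%:R * shifted_bound)%:E)%E.
    rewrite -integral_cst //.
    apply: (@le_trans _ _ (\int[mu]_(w in B)
        (\sum_(z <- s) (shifted_kernel N z w)%:E))%E).
      apply: ge0_le_integral => //.
      - by move=> w _; rewrite lee_fin ltW.
      - by apply: emeasurable_sum => z; exact: measurable_shifted_kernel.
    rewrite ge0_integral_sum //; last 2 first.
    - by move=> z; exact: measurable_shifted_kernel.
    - by move=> z w /BA Aw; rewrite lee_fin shifted_kernel_ge0.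
    apply: (@le_trans _ _ (\sum_(z <- s) shifted_bound%:E)%E); last first.
      by rewrite sumEFin lee_fin big_const_seq count_predT iter_addr_0 mulr_natl.
    apply: lee_sum => z _; apply: le_trans (integral_shifted_kernel_le N z).
    apply: ge0_subset_integral => //; first exact: measurable_shifted_kernel.
    by move=> w Aw; rewrite lee_fin shifted_kernel_ge0.
  rewrite mE lee_fin /t divfK ?gt_eqF //; lra.
exists w => //; have Aw := BA _ Bw.
have sk_lt z : z \in s -> shifted_kernel N z w < N%:R.
  move=> zs; apply: le_lt_trans tN; apply: le_trans (ltW sum_lt).
  rewrite (big_rem z) //= lerDl; apply: sumr_ge0 => y _; exact: shifted_kernel_ge0.
have sk_mod z : z \in s -> 0 < modC (z - w) /\
    shifted_kernel N z w = ln (supp_bound z) - ln (modC (z - w)).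
  move=> /sk_lt; rewrite /shifted_kernel => lt_N.
  have [|-> ->//] := @trunc_kernel_modC _ N z w.
  by have := ln_ge0 (supp_bound_ge1 z); lra.
have prod0 : 0 < \prod_(z <- s) modC (z - w).
  by rewrite big_seq; apply: prodr_gt0 => z /sk_mod[].
have prodE : \prod_(z <- s) supp_bound z =
    expR (\sum_(z <- s) shifted_kernel N z w) * \prod_(z <- s) modC (z - w).
  rewrite expR_sum -big_split /= big_seq [RHS]big_seq.
  apply: eq_bigr => z /sk_mod[m_gt0 ->].
  have s0 : 0 < supp_bound z by exact: lt_le_trans (supp_bound_ge1 z).
  by rewrite -ln_div ?posrE // lnK ?posrE ?divr_gt0 // divfK ?gt_eqF.
apply: (@le_trans _ _ (\prod_(z <- s) supp_bound z)).
  apply: ler_prod => z _; rewrite addr_ge0 ?modC_ge0 //= /supp_bound.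
  by rewrite ler_peMl ?addr_ge0 ?modC_ge0 // lerDl.
rewrite prodE ler_wpM2r ?(ltW prod0) //.
apply: (@le_trans _ _ (expR t)); first by rewrite ler_expR ltW.
rewrite -expRM_natl ler_expR mulrA ler_wpM2r ?invr_ge0 ?(ltW m0) //.
by rewrite -natr1; have := shifted_bound_ge0; have : 0 <= (size s)%:R :> R by []; nra.
Qed.

End BoundedPotential.

(** * Coefficients of polynomials bounded on a nonpolar set *)

Section Polynomials.
Variable R : realType.
Implicit Types (p : {poly R[i]}) (s : seq R[i]).

Lemma modC_coef_prod_le s k :
  modC (\prod_(z <- s) ('X - z%:P))`_k <= \prod_(z <- s) (1 + modC z).
Proof.
elim: s k => [|z s IHs] k.
  by rewrite !big_nil coef1; case: eqP; rewrite ?modC1 ?modC0.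
rewrite !big_cons mulrBl coefB coefXM coefCM.
apply: (le_trans (modC_leD _ _)); rewrite modCN modCM [leRHS]mulrDl mul1r.
apply: lerD; last by rewrite ler_wpM2l ?modC_ge0.
case: ifP => _ //; rewrite modC0 prodr_ge0 // => y _.
by rewrite addr_ge0 ?modC_ge0.
Qed.

Lemma modC_horner_roots (c : R[i]) s w :
  modC (c *: \prod_(z <- s) ('X - z%:P)).[w] = modC c * \prod_(z <- s) modC (z - w).
Proof.
rewrite hornerZ modCM horner_prod modC_prod; congr (_ * _).
by apply: eq_bigr => z _; rewrite hornerXsubC -modCN opprB.
Qed.

(** The factorization over the roots reduces measurability to that of the distances
|z - w|. *)
Lemma measurable_modC_horner p :
  measurable_fun [set: borelC R] (fun w : borelC R => modC p.[w]).
Proof.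
have [s ->] := closed_field_poly_normal p; set c := lead_coef p.
under eq_fun do rewrite modC_horner_roots.
apply: measurable_funM => //; apply: measurable_prod => z _.
exact: measurable_modC_sub.
Qed.

(** At the point w of [exists_large_product], |p(w)| is the leading coefficient times
the product of the |z - w|, so it dominates every coefficient of p up to
the factor C ^+ size p. *)
Lemma coef_le_of_bounded (mu : probability (borelC R) R)
    (A B : set (borelC R)) (r M : R) :
    measurable A -> mu A = 1%E -> 0 <= r -> (forall w : R[i], A w -> modC w <= r) ->
    (forall z : R[i], (log_potential mu z <= M%:E)%E) ->
    measurable B -> B `<=` A -> (0 < mu B)%E ->
  exists2 C : R, 0 <= C & forall p (b : R), (forall w, B w -> modC p.[w] <= b) ->
    forall k, modC p`_k <= C ^+ size p * b.
Proof.
move=> mA muA r0 Ar muM mB BA muB.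
have [C C0 prodC] := exists_large_product mA muA r0 Ar muM mB BA muB.
exists C => // p b pb k.
have [p0|p_neq0] := eqVneq p 0.
  have [w Bw _] := prodC [::].
  rewrite p0 coef0 size_poly0 expr0 mul1r modC0 (le_trans _ (pb w Bw)) //.
  exact: modC_ge0.
have [s ps] := closed_field_poly_normal p.
have c0 : lead_coef p != 0 by rewrite lead_coef_eq0.
have size_p : size p = (size s).+1 by rewrite ps size_scale // size_prod_XsubC.
have [w Bw prod_le] := prodC s.
have := pb w Bw; rewrite {1}ps modC_horner_roots => pwb.
rewrite size_p [in leLHS]ps coefZ modCM.
apply: (le_trans (ler_wpM2l (modC_ge0 _) (modC_coef_prod_le s k))).
apply: (le_trans (ler_wpM2l (modC_ge0 _) prod_le)).
by rewrite mulrCA ler_wpM2l ?exprn_ge0.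
Qed.

End Polynomials.

Section Capacity.
Variable R : realType.

(** Positive capacity means that on some truncation of E a measure with
potential bounded above exists. *)
Lemma capacity_gt0 (E : set R[i]) : (0 < cap E)%E ->
  exists (n : nat) (mu : probability (borelC R) R) (M : R),
    mu (E `&` [set z | (modC z <= n%:R)%R]) = 1%E /\
    forall z : R[i], (log_potential mu z <= M%:E)%E.
Proof.
move=> capE.
have [n capn] : exists n : nat,
    (0 < cap_compact (E `&` [set z | (modC z <= n%:R)%R]))%E.
  apply: contrapT => no_n.
  suff cap0 : cap E = 0%E by rewrite cap0 ltxx in capE.
  rewrite /cap (_ : (fun n : nat => _) = cst 0%E); first exact: lim_cst.
  apply/funext => n; apply/eqP; rewrite eq_le expeR_ge0 andbT leNgt.
  by apply/negP => pos; apply: no_n; exists n.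
move: capn; rewrite /cap_compact lt_def expeR_eq0 expeR_ge0 andbT.
set S := [set _ | mu in _] => infS.
have : (ereal_inf S < +oo)%E by rewrite ltey; apply: contra infS => /eqP->.
move=> /ereal_inf_lt[_ [mu mu1 <-]] sup_lty; exists n, mu.
have [M supM] : exists M : R, (ereal_sup (range (log_potential mu)) <= M%:E)%E.
  case: ereal_sup sup_lty => [M _|//|_]; first by exists M.
  by exists 0; rewrite leNye.
exists M; split=> // z; apply: le_trans supM; apply: ereal_sup_ubound.
by exists z.
Qed.

End Capacity.

(** * Roots of polynomials over convergent series *)

Section Algebraic.
Variable R : realType.
Notation fpsC := (fps R[i]).
Implicit Types (F : {poly fpsC}) (u : fpsC).

(** Replacing F by its derivative while u is a multiple root ends at a simple root,
since the characteristic is zero. *)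
Lemma algebraic_convergent F u : F \is a polyOver (@convergent_fps R) ->
  F != 0 -> F.[u] = 0 -> u \in @convergent_fps R.
Proof.
have [n] := ubnP (size F); elim: n F => // n IHn F; rewrite ltnS => le_Fn Fc F0 Fu.
have [dFu|dFu] := eqVneq F^`().[u] 0; last exact: simple_root_convergent dFu.
apply: (IHn F^`()) => //; [|exact: polyOver_deriv|].
  apply: leq_trans le_Fn; exact: lt_size_deriv.
apply: contraNneq F0 => dF0.
suff /size1_polyC FE : (size F <= 1)%N.
  by rewrite FE polyC_eq0; apply/eqP; move: Fu; rewrite {1}FE hornerC.
apply/leq_sizeP => -[//|j] _; apply/funext => i.
move/(congr1 (fun p : {poly fpsC} => p`_j i)): dF0; rewrite coef_deriv coef0.
by move/eqP; rewrite coef_fpsMn mulrn_eq0 => /eqP.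
Qed.

Lemma polynomial_value_convergent F u (j : nat) :
    F \is a polyOver (@convergent_fps R) ->
  F.[u] \in @convergent_fps R -> (0 < j)%N -> F`_j != 0 -> u \in @convergent_fps R.
Proof.
move=> Fc Fuc j0 Fj; apply: (@algebraic_convergent (F - F.[u]%:P)).
- by rewrite rpredB ?polyOverC.
- apply: contraNneq Fj => /(congr1 (fun p : {poly fpsC} => p`_j)).
  by rewrite coefB coefC coef0 gtn_eqF // subr0 => ->.
- by rewrite hornerD hornerN hornerC subrr.
Qed.

End Algebraic.

(** * From pointwise to uniform geometric bounds *)

Section UniformBound.
Variable R : realType.

(** The sets B k of points with constant at most k exhaust a set of full measure, so
one of them has positive measure and [coef_le_of_bounded] applies to it. *)
Lemma polynomial_coefs_bounded (E : set R[i]) (W : nat -> {poly R[i]}) (D : nat) :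
    closed_in_Cstar E -> (0 < cap E)%E -> (forall n, (size (W n) <= D * n + 1)%N) ->
    (forall s, E s -> fps_convergent (fun n => (W n).[s])) ->
  exists2 C : R, 1 <= C & forall n k, (0 < n)%N -> modC (W n)`_k <= C ^+ n.
Proof.
move=> [F cF EF] /capacity_gt0[r [mu [M [muA muM]]]] sizeW convW.
set A : set (borelC R) := E `&` _ in muA.
have m_disc p (b : R) : measurable ([set w | modC p.[w] <= b] : set (borelC R)).
  have := @measurable_modC_horner R p measurableT `]-oo, b]%classic.
  by rewrite setTI; apply; exact: measurable_itv.
have mA : measurable A.
  have -> : A = F `&` ~` [set w | modC ('X : {poly R[i]}).[w] <= 0] `&`
                [set w | modC ('X : {poly R[i]}).[w] <= r%:R].
    rewrite /A EF; apply/seteqP; split=> w /=; rewrite hornerX.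
      move=> [[Fw w0] wr]; split=> //; split=> // w_le; apply: w0.
      by apply/eqP; rewrite -modC_eq0 eq_le w_le modC_ge0.
    by move=> [[Fw w0] wr]; split=> //; split=> // w_eq; apply: w0; rewrite w_eq modC0.
  apply: measurableI; first apply: measurableI; first exact: closed_measurableC.
  - by apply: measurableC; exact: m_disc.
  - exact: m_disc.
pose B k : set (borelC R) :=
  A `&` \bigcap_(n in [set n | (0 < n)%N]) [set w | modC (W n).[w] <= k%:R ^+ n].
have mB k : measurable (B k).
  by apply: measurableI => //; apply: bigcap_measurable => [|n _];
    [exists 1%N|exact: m_disc].
have [k muB] : exists k, (0 < mu (B k))%E.
  apply: contrapT => no_k.
  have : mu.-negligible (\bigcup_k B k).
    apply: negligible_bigcup => k; exists (B k); split=> //.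
    apply/eqP; rewrite eq_le measure_ge0 andbT leNgt.
    by apply/negP => pos; apply: no_k; exists k.
  have -> : \bigcup_k B k = A.
    apply/seteqP; split=> [w [k _ []] //|w Aw].
    have [C WC] := convW w Aw.1.
    pose k := Num.Def.archi_bound `|C|.
    have Ck : `|C| <= k%:R by exact/ltW/archi_boundP.
    exists k => //; split=> // n /= n0.
    apply: (le_trans (WC n n0)); rewrite (le_trans (ler_norm _)) // normrX.
    by rewrite lerXn2r ?nnegrE.
  move=> /(measure_negligible mA) muA0.
  by move/eqP: (etrans (esym muA) muA0); rewrite onee_eq0.
have A_r w : A w -> modC w <= r%:R by case.
have [C C0 WC] := coef_le_of_bounded mA muA (ler0n _ _) A_r muM (mB k)
  (@subIsetl _ _ _) muB.
pose C1 := C + 1; have C1_ge1 : 1 <= C1 by rewrite lerDr.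
exists (C1 ^+ (D + 1) * (k%:R + 1)).
  by rewrite (@mulr_ege1 _ (C1 ^+ _)) ?exprn_ege1 ?lerDr.
move=> n j n0; apply: (le_trans (WC (W n) (k%:R ^+ n) _ j)).
  by move=> w [_]; apply.
rewrite exprMn -exprM; apply: ler_pM; rewrite ?exprn_ge0 //.
- apply: (@le_trans _ _ (C1 ^+ size (W n))).
    by rewrite lerXn2r ?nnegrE ?lerDl // (le_trans ler01).
  rewrite ler_weXn2l // (leq_trans (sizeW n)) // mulnDl mul1n.
  by rewrite leq_add2l.
- by rewrite lerXn2r ?nnegrE ?addr_ge0 ?lerDl.
Qed.

End UniformBound.

(** * The coefficients of g(c x, d h) as polynomials in the dilation *)

Section Dilations.
Variable K : comNzRingType.
Notation X := (fps_X : fps K).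
Implicit Types (g : nat -> nat -> K) (h : fps K).

Lemma fps_scaleE (c : K) (u : fps K) : fps_scale c u = fps_const c * u.
Proof. by apply/funext => n; rewrite coef_fps_constM. Qed.

Lemma fps_constX (c : K) n : fps_const c ^+ n = fps_const (c ^+ n).
Proof.
elim: n => [|n IHn]; first by apply/funext => -[].
rewrite !exprS IHn; apply/funext => i; rewrite coef_fps_constM.
by case: i => [//|i]; rewrite /= mulr0.
Qed.

Lemma fps_subst2_scale g h (c d : K) n :
  fps_subst2 g (fps_scale c fps_X) (fps_scale d h) n =
  \sum_(i < n.+1) \sum_(j < n.+1) g i j * (X ^+ i * h ^+ j) n * (c ^+ i * d ^+ j).
Proof.
apply: eq_bigr => i _; apply: eq_bigr => j _; rewrite -mulrA; congr (_ * _).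
rewrite !fps_scaleE !fps_expE !exprMn !fps_constX.
rewrite -[LHS]/(((fps_const (c ^+ i) * X ^+ i) * (fps_const (d ^+ j) * h ^+ j)) n).
rewrite mulrACA -mulrA !coef_fps_constM; ring.
Qed.

(** The exponent function e is a parameter because negative sigma and tau require the
reversed polynomial, with exponents D n - (a i + b j). *)
Definition dilation_poly (e : nat -> nat -> nat) g h (n : nat) : {poly K} :=
  \sum_(i < n.+1) \sum_(j < n.+1) (g i j * (X ^+ i * h ^+ j) n) *: 'X^(e i j).

Lemma horner_dilation_poly e g h n (s : K) : (dilation_poly e g h n).[s] =
  \sum_(i < n.+1) \sum_(j < n.+1) g i j * (X ^+ i * h ^+ j) n * s ^+ e i j.
Proof.
rewrite horner_sum; apply: eq_bigr => i _; rewrite horner_sum; apply: eq_bigr => j _.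
by rewrite hornerZ hornerXn.
Qed.

Lemma size_dilation_poly e g h n (D : nat) :
    (forall i j, (i <= n)%N -> (j <= n)%N -> (e i j <= D)%N) ->
  (size (dilation_poly e g h n) <= D + 1)%N.
Proof.
move=> e_le; apply: (leq_trans (size_sum _ _ _)); apply/bigmax_leqP => i _.
apply: (leq_trans (size_sum _ _ _)); apply/bigmax_leqP => j _.
apply: (leq_trans (size_scale_leq _ _)); rewrite size_polyXn addn1 ltnS.
by rewrite e_le // -ltnS.
Qed.

(** [isobaric_poly a b g m] is the part of weight m of g(x, Y), for x of weight a and Y
of weight b, seen as a polynomial in Y over the power series in x. *)
Definition isobaric_coef (a b : nat) g (m j : nat) : fps K :=
  fun i => if (a * i + b * j == m)%N then g i j else 0.

Definition isobaric_poly (a b : nat) g (m : nat) : {poly fps K} :=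
  \poly_(j < m.+1) isobaric_coef a b g m j.

(** Since b > 0, weight m forces j <= m, so that for n >= m the truncation at n of the
substitution contains the whole isobaric part. *)
Lemma coef_dilation_poly (a b : nat) e g h n k m :
    (0 < b)%N -> (m <= n)%N ->
    (forall i j, (i <= n)%N -> (j <= n)%N -> (e i j == k) = (a * i + b * j == m)%N) ->
  (dilation_poly e g h n)`_k = (isobaric_poly a b g m).[h] n.
Proof.
move=> b0 le_mn e_k.
pose G j i : K := (if (a * i + b * j == m)%N then g i j else 0) * (h ^+ j) (n - i)%N.
transitivity (\sum_(i < n.+1) \sum_(j < n.+1) G j i).
  rewrite coef_sum; apply: eq_bigr => i _; rewrite coef_sum; apply: eq_bigr => j _.
  have [le_in le_jn] : (i <= n /\ j <= n)%N by split; rewrite -ltnS.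
  rewrite coefZ coefXn eq_sym e_k // coef_fps_XnM le_in /G.
  by case: ifP => _; rewrite ?mulr1 // mulr0 mul0r.
rewrite exchange_big horner_poly coef_fps_sum /=.
rewrite [RHS](big_ord_widen n.+1 (fun j => \sum_(i < n.+1) G j i)) ?ltnS //.
rewrite [RHS]big_mkcond /=; apply: eq_bigr => j _; case: ltnP => // lt_mj.
rewrite big1 // => i _; rewrite /G; case: eqP => [ij_m|_]; last by rewrite mul0r.
suff : (m < m)%N by rewrite ltnn.
rewrite -[in ltnRHS]ij_m (leq_trans lt_mj) //.
by rewrite (leq_trans _ (leq_addl _ _)) // leq_pmull.
Qed.

End Dilations.

(** * Convergence of h *)

Section Main.
Variable R : realType.
Implicit Types (g : nat -> nat -> R[i]) (h : fps R[i]).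

(** The two alternatives are the positive and the negative signs of sigma and tau; in
the second one, s^(D n) clears the denominators of the n-th coefficient. *)
Lemma isobaric_value_bounded g h (E : set R[i]) (a b m : nat) :
    (0 < a)%N -> (0 < b)%N -> closed_in_Cstar E -> (0 < cap E)%E ->
    (forall s : R[i], E s -> fps_convergent
      (fps_subst2 g (fps_scale (s ^+ a) fps_X) (fps_scale (s ^+ b) h))) \/
    (forall s : R[i], E s -> fps_convergent
      (fps_subst2 g (fps_scale (s^-1 ^+ a) fps_X) (fps_scale (s^-1 ^+ b) h))) ->
  exists2 C : R, 1 <= C & forall n, (m < n)%N ->
    modC ((isobaric_poly a b g m).[h] n) <= C ^+ n.
Proof.
move=> a0 b0 cE capE; pose D := (a + b)%N.
have wt_le n i j : (i <= n)%N -> (j <= n)%N -> (a * i + b * j <= D * n)%N.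
  by move=> le_in le_jn; rewrite mulnDl leq_add // leq_mul2l ?le_in ?le_jn orbT.
case=> conv.
- pose W n := dilation_poly (fun i j => a * i + b * j)%N g h n.
  have [||C C1 WC] := @polynomial_coefs_bounded R E W D cE capE.
  + by move=> n; apply: size_dilation_poly => i j; exact: wt_le.
  + move=> s /conv; congr fps_convergent; apply/funext => n.
    rewrite fps_subst2_scale horner_dilation_poly.
    by do 2!apply: eq_bigr => ? _; rewrite -!exprM exprD.
  exists C => // n lt_mn.
  rewrite -(@coef_dilation_poly _ a b (fun i j => a * i + b * j)%N _ _ n m) //.
    by apply: WC; apply: leq_ltn_trans lt_mn.
  exact: ltnW.
pose e n i j := (D * n - (a * i + b * j))%N.
pose W n := dilation_poly (e n) g h n.
have [||C C1 WC] := @polynomial_coefs_bounded R E W D cE capE.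
- by move=> n; apply: size_dilation_poly => i j _ _; exact: leq_subr.
- move=> s Es; have s0 : s != 0 by case: cE Es => F _ -> [_ /eqP].
  have [C sC] := conv s Es; exists (modC s ^+ D * C) => n n0.
  have -> : (W n).[s] = s ^+ (D * n) *
      fps_subst2 g (fps_scale (s^-1 ^+ a) fps_X) (fps_scale (s^-1 ^+ b) h) n.
    rewrite fps_subst2_scale horner_dilation_poly mulr_sumr.
    apply: eq_bigr => i _; rewrite mulr_sumr; apply: eq_bigr => j _.
    rewrite [RHS]mulrCA; congr (_ * _).
    have le_wt : (a * i + b * j <= D * n)%N by rewrite wt_le // -ltnS ltn_ord.
    by rewrite -!exprM -exprD exprVn /e expfB_cond ?(negPf s0).
  rewrite modCM modCX exprMn -exprM ler_wpM2l ?exprn_ge0 ?modC_ge0 //.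
  exact: sC.
exists C => // n lt_mn.
have le_mD : (m <= D * n)%N.
  by rewrite (leq_trans (ltnW lt_mn)) // leq_pmull // addn_gt0 a0.
rewrite -(@coef_dilation_poly _ a b (e n) _ _ n (D * n - m)%N m) //.
- by apply: WC; apply: leq_ltn_trans lt_mn.
- exact: ltnW.
by move=> i j le_in le_jn; have := wt_le n i j le_in le_jn; rewrite /e; lia.
Qed.

Lemma convergent_of_eventually u (C : R) (m : nat) : 1 <= C ->
  (forall n, (m < n)%N -> modC (u n) <= C ^+ n) -> u \in @convergent_fps R.
Proof.
move=> C1 uC; rewrite -(convergent_fps_shift m.+1); apply/convergent_fpsP.
exists (C ^+ m.+2) => k k0; rewrite /fps_shift (le_trans (uC _ _)) ?ltn_addl //.
rewrite -exprM ler_weXn2l //; nia.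
Qed.

(** A coefficient of g that depends on y selects the weight m, and then the isobaric
part of weight m is a nonconstant polynomial with convergent value at h. *)
Lemma convergent_of_dilations g h (E : set R[i]) (a b : nat) :
    fps_dy g <> 0 -> (0 < a)%N -> (0 < b)%N -> closed_in_Cstar E -> (0 < cap E)%E ->
    (forall s : R[i], E s -> fps_convergent
      (fps_subst2 g (fps_scale (s ^+ a) fps_X) (fps_scale (s ^+ b) h))) \/
    (forall s : R[i], E s -> fps_convergent
      (fps_subst2 g (fps_scale (s^-1 ^+ a) fps_X) (fps_scale (s^-1 ^+ b) h))) ->
  fps_convergent h.
Proof.
move=> dg a0 b0 cE capE conv.
have [i [j gij]] : exists i j, g i j.+1 != 0.
  apply: contrapT => g0; apply: dg; apply/funext => i; apply/funext => j.
  rewrite /fps_dy; have [->|gij] := eqVneq (g i j.+1) 0; first exact: mul0rn.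
  by case: g0; exists i, j.
pose m := (a * i + b * j.+1)%N.
have [C C1 hC] := isobaric_value_bounded m a0 b0 cE capE conv.
apply/convergent_fpsP.
apply: (@polynomial_value_convergent _ (isobaric_poly a b g m) h j.+1) => //.
- apply/polyOverP => l; rewrite coef_poly; case: ifP => _; last exact: rpred0.
  apply: (@convergent_fps_fin _ m.+1) => n lt_mn.
  rewrite /isobaric_coef; case: eqP => // nl_m.
  have le_nm : (n <= m)%N.
    by rewrite -nl_m (leq_trans _ (leq_addr _ _)) // leq_pmull.
  by rewrite leqNgt lt_mn in le_nm.
- exact: convergent_of_eventually hC.
have lt_jm : (j.+1 < m.+1)%N.
  by rewrite ltnS (leq_trans _ (leq_addl _ _)) // leq_pmull.
rewrite coef_poly lt_jm; apply: contraNneq gij => /(congr1 (fun u : fps R[i] => u i)).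
by rewrite /isobaric_coef eqxx => ->.
Qed.

End Main.

Unset Implicit Arguments.

Theorem theorem1p2 (R : realType)
    (g : nat -> nat -> R[i]) (h : nat -> R[i])
    (E : set R[i]) (sigma tau : int)
    (hg : fps_dy g <> 0)
    (h_neq0 : h <> 0)
    (h0 : h 0%N = 0)
    (closedE : closed_in_Cstar E)
    (capE : (0 < cap E)%E)
    (sigmatau : 0 < sigma * tau)
    (conv : forall s : R[i], E s ->
      fps_convergent
        (fps_subst2 g (fps_scale (s ^ sigma) fps_X) (fps_scale (s ^ tau) h))) :
  fps_convergent h.
Proof.
case: sigma tau sigmatau conv => [a|a] [b|b] sigmatau conv.
- have [a0 b0] : (0 < a)%N /\ (0 < b)%N.
    by case: a b sigmatau {conv} => [|a] [|b] //; rewrite ?mul0r ?mulr0 ltxx.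
  by apply: (convergent_of_dilations hg a0 b0 closedE capE); left.
- by move: sigmatau; rewrite NegzE mulrN oppr_gt0 ltNge mulr_ge0.
- by move: sigmatau; rewrite NegzE mulNr oppr_gt0 ltNge mulr_ge0.
apply: (convergent_of_dilations hg (ltn0Sn a) (ltn0Sn b) closedE capE); right.
by move=> s /conv; rewrite !exprVn.
Qed.
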